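(* The two-stage selection problem with two-stage discrete budgeted uncertainty and with $\Gamma=1$, $\underline{c}=\underline{d}$ and $\overline{c}=\overline{d}$ can be solved in $O(n^5)$ time.
   Context: Notation: $[n]=\{1,\dots,n\}$, $\min\emptyset=\infty$. Selection: $\mathcal{X}_{\rm nom}=\{x\in\{0,1\}^n:\sum_{i\in[n]}x_i=p\}$ for a given integer $p$. Put $\mathcal{X}=\{0,1\}^n$ and $\mathcal{X}(x)=\{y\in\{0,1\}^n: x+y\le\mathbf{1},\ x+y\in\mathcal{X}_{\rm nom}\}$. Two-stage discrete budgeted uncertainty: given vectors with $0\le\underline{c}_i\le\overline{c}_i$, $0\le\underline{d}_i\le\overline{d}_i$ ($i\in[n]$) and an integer $\Gamma\ge0$, $$\mathcal{U}=\{c\in\mathbb{R}^n_+: c_i=\underline{c}_i+(\overline{c}_i-\underline{c}_i)\delta_i,\ \delta_i\in\{0,1\}\ \forall i\in[n],\ \textstyle\sum_{i}\delta_i\le\Gamma\},$$ $$\mathcal{U}(c)=\{d\in\mathbb{R}^n_+: d_i=\underline{d}_i+(\overline{d}_i-\underline{d}_i)\delta_i,\ \delta_i\in\{0,1\}\ \forall i\in[n],\ \textstyle\sum_i\delta_i\le\Gamma-\sum_{i}\frac{c_i-\underline{c}_i}{\overline{c}_i-\underline{c}_i}\},$$ where a fraction with $\overline{c}_i=\underline{c}_i$ is read as $0$. The two-stage problem is to compute $$\textsc{Rob}=\min_{x\in\mathcal{X}}\max_{c\in\mathcal{U}}\min_{y\in\mathcal{X}(x)}\max_{d\in\mathcal{U}(c)}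 c^tx+d^ty .$$ *)

(* Defs.v *)
From mathcomp Require Import all_boot all_order all_algebra.
From mathcomp Require Import boolp classical_sets reals constructive_ereal ereal.

Set Implicit Arguments.
Unset Strict Implicit.
Unset Printing Implicit Defensive.

Import Order.TTheory GRing.Theory Num.Theory.

Local Open Scope classical_set_scope.
Local Open Scope ring_scope.

Record instance (R : realType) (n : nat) := Instance {
  psel : int;       (* the integer p *)
  Gamma : nat;
  clo : 'rV[R]_n;
  chi : 'rV[R]_n;
  dlo : 'rV[R]_n;
  dhi : 'rV[R]_n
}.

Section Problem.
Variables (R : realType) (n : nat).
Implicit Types (I : instance R n) (x y c d delta : 'rV[R]_n).

Definition valid I : Prop :=
  forall i, (0 <= clo I 0 i <= chi I 0 i) /\ (0 <= dlo I 0 i <= dhi I 0 i).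

Definition zero_one x : Prop := forall i, x 0 i = 0 \/ x 0 i = 1.

Definition nonneg x : Prop := forall i, 0 <= x 0 i.

Definition dot c x : R := \sum_(i < n) c 0 i * x 0 i.

Definition Xnom I : set 'rV[R]_n :=
  [set z | zero_one z /\ \sum_(i < n) z 0 i = (psel I)%:~R].

Definition X1 : set 'rV[R]_n := [set x | zero_one x].

Definition X2 I x : set 'rV[R]_n :=
  [set y | [/\ zero_one y, (forall i, (x + y) 0 i <= 1) & Xnom I (x + y)]].

Definition U1 I : set 'rV[R]_n :=
  [set c | nonneg c /\ exists delta,
    [/\ zero_one delta,
        (forall i, c 0 i = clo I 0 i + (chi I 0 i - clo I 0 i) * delta 0 i)
      & \sum_(i < n) delta 0 i <= (Gamma I)%:R]].

(* A fraction with zero denominator is 0, by the library's convention on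
   division in a field. *)
Definition U2 I c : set 'rV[R]_n :=
  [set d | nonneg d /\ exists delta,
    [/\ zero_one delta,
        (forall i, d 0 i = dlo I 0 i + (dhi I 0 i - dlo I 0 i) * delta 0 i)
      & \sum_(i < n) delta 0 i <=
        (Gamma I)%:R
        - \sum_(i < n) (c 0 i - clo I 0 i) / (chi I 0 i - clo I 0 i)]].

(* All four sets are finite, and U1 I and U2 I c (for c in U1 I) are nonempty
   when I is valid, so each supremum is a maximum and each infimum a minimum,
   with min set0 = +oo. *)
Definition Rob I : \bar R :=
  ereal_inf [set
    ereal_sup [set
      ereal_inf [set
        ereal_sup [set (dot c x + dot d y)%:E | d in U2 I c]
      | y in X2 I x]
    | c in U1 I]
  | x in X1].

End Problem.

(* A real RAM with unit-cost operations. A program is a finite piece of syntax,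
   independent of n and of the data. It works on an integer memory and a real
   memory, both addressed by integers (indirect addressing is a read or write
   at a computed address). To keep unit costs honest, integers can only be
   added, subtracted and compared, and there is no rounding from reals to
   integers. *)

Inductive iexp :=
  | IConst of int
  | IRead of iexp
  | IAdd of iexp & iexp
  | ISub of iexp & iexp.

Inductive rexp :=
  | RConst of int
  | RRead of iexp
  | RAdd of rexp & rexp
  | RSub of rexp & rexp
  | RMul of rexp & rexp
  | RDiv of rexp & rexp.

Inductive bexp :=
  | BIle of iexp & iexp
  | BRle of rexp & rexp
  | BNot of bexp
  | BAnd of bexp & bexp.

Inductive com :=
  | Skip
  | IWrite of iexp & iexp      (* address, value *)
  | RWrite of iexp & rexp      (* address, value *)
  | Seq of com & com
  | If of bexp & com & com
  | While of bexp & com.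

Fixpoint icost (e : iexp) : nat :=
  match e with
  | IConst _ => 1
  | IRead a => (icost a).+1
  | IAdd e1 e2 | ISub e1 e2 => (icost e1 + icost e2).+1
  end.

Fixpoint rcost (e : rexp) : nat :=
  match e with
  | RConst _ => 1
  | RRead a => (icost a).+1
  | RAdd e1 e2 | RSub e1 e2 | RMul e1 e2 | RDiv e1 e2 =>
      (rcost e1 + rcost e2).+1
  end.

Fixpoint bcost (b : bexp) : nat :=
  match b with
  | BIle e1 e2 => (icost e1 + icost e2).+1
  | BRle e1 e2 => (rcost e1 + rcost e2).+1
  | BNot b1 => (bcost b1).+1
  | BAnd b1 b2 => (bcost b1 + bcost b2).+1
  end.

Record state (R : realType) := State { imem : int -> int; rmem : int -> R }.

Section Semantics.
Variable R : realType.
Implicit Types s : state R.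

Fixpoint ieval s (e : iexp) : int :=
  match e with
  | IConst z => z
  | IRead a => imem s (ieval s a)
  | IAdd e1 e2 => ieval s e1 + ieval s e2
  | ISub e1 e2 => ieval s e1 - ieval s e2
  end.

Fixpoint reval s (e : rexp) : R :=
  match e with
  | RConst z => z%:~R
  | RRead a => rmem s (ieval s a)
  | RAdd e1 e2 => reval s e1 + reval s e2
  | RSub e1 e2 => reval s e1 - reval s e2
  | RMul e1 e2 => reval s e1 * reval s e2
  | RDiv e1 e2 => reval s e1 / reval s e2
  end.

Fixpoint beval s (b : bexp) : bool :=
  match b with
  | BIle e1 e2 => ieval s e1 <= ieval s e2
  | BRle e1 e2 => reval s e1 <= reval s e2
  | BNot b1 => ~~ beval s b1
  | BAnd b1 b2 => beval s b1 && beval s b2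
  end.

Definition upd (T : Type) (m : int -> T) (a : int) (v : T) : int -> T :=
  fun z => if z == a then v else m z.

(* [exec P s t s']: started in s, the program P halts in s' after t steps. *)
Inductive exec : com -> state R -> nat -> state R -> Prop :=
  | ExecSkip s : exec Skip s 1 s
  | ExecIWrite s a e :
      exec (IWrite a e) s (icost a + icost e).+1
        (State (upd (imem s) (ieval s a) (ieval s e)) (rmem s))
  | ExecRWrite s a e :
      exec (RWrite a e) s (icost a + rcost e).+1
        (State (imem s) (upd (rmem s) (ieval s a) (reval s e)))
  | ExecSeq P Q s s' s'' t t' :
      exec P s t s' -> exec Q s' t' s'' -> exec (Seq P Q) s (t + t') s''
  | ExecIf b P Q s s' t :
      exec (if beval s b then P else Q) s t s' ->
      exec (If b P Q) s (bcost b + t).+1 s'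
  | ExecWhileF b P s :
      ~~ beval s b -> exec (While b P) s (bcost b).+1 s
  | ExecWhileT b P s s' s'' t t' :
      beval s b -> exec P s t s' -> exec (While b P) s' t' s'' ->
      exec (While b P) s (bcost b + t + t').+1 s''.

(* Input: n, p, Gamma in integer cells 0, 1, 2; the entries of clo, chi, dlo,
   dhi, in this order, in real cells 0, ..., 4n - 1; 0 everywhere else. *)
Definition encode_instance n (I : instance R n) : state R :=
  State
    (fun z => if z == 0 then Posz n else if z == 1 then psel I
              else if z == 2 then Posz (Gamma I) else 0)
    (fun z => if z is Posz k then
                nth 0 (flatten
                         [seq [seq v 0 i | i <- enum 'I_n]
                         | v : 'rV[R]_n <- [:: clo I; chi I; dlo I; dhi I]]) k
              else 0).

(* Output: integer cell 0 holds 0 if the value is +oo; otherwise it is nonzero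
   and the value is in real cell 0. *)
Definition decode_output (s : state R) : \bar R :=
  if imem s 0 == 0 then +oo%E else (rmem s 0)%:E.

End Semantics.

(* Main.v *)
Require Import Defs.
From mathcomp Require Import all_boot all_order all_algebra.
From mathcomp Require Import zify.
From mathcomp Require Import boolp classical_sets reals constructive_ereal ereal.
From mathcomp Require Import fintype finset.

Set Implicit Arguments.
Unset Strict Implicit.
Unset Printing Implicit Defensive.

Import Order.TTheory GRing.Theory Num.Theory.

Local Open Scope ring_scope.

(** Write [a = clo = dlo] for the cost vector and [w = chi - clo >= 0] for the
    deviations. With a single unit of budget the adversary either spends it in
    the first stage or keeps it for the second. If it strikes an item of the
    first-stage set [X], the second stage is undisturbed and the total is the
    greatest [w] on [X] plus the least [a]-cost of a [p]-set [Z2] containing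
    [X]; otherwise the total is [a(Z1)] plus the greatest [w] on [Z1 \ X],
    minimised over the [p]-sets [Z1] containing [X]. Hence (lemmas [Rob_le] and
    [le_Rob]) the robust value is the minimum, over [X] contained in [Z1] and
    in [Z2], of [max (a(Z1) + max w on Z1 \ X) (a(Z2) + max w on X)].

    Let [w_i] and [w_j] be the two inner maxima. An item of [X] with deviation
    at most [w_i] may as well be postponed: [Z1] does not change, the bound
    [w_i] still holds on [Z1 \ X], and [Z2] only becomes less constrained. So
    [X] can be taken inside the medium items [M = (w_i < w <= w_j)], and
    [Z1 \ X] inside the light items [L = (w <= w_i)]. Once [k = #|X|] is also
    fixed, an exchange argument ([cheapest_exchange]) shows that both terms are
    minimised by the same [X], the [k] cheapest items of [M]: it is completed
    to [Z1] by the [p - k] cheapest items of [L] and to [Z2] by the [p - k]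
    cheapest of all remaining items. When every item of [X] can be postponed,
    and also when [Z1 = X], the value is matched by [k = 0] and [i = j].

    The program tries all triples [(i, j, k)]. It finds the cheapest items by
    rank: an item belongs to the [k] cheapest of [M] when fewer than [k] items
    of [M] precede it in the order by cost, ties being broken by index. Two
    more nested loops, over the item and over its predecessors, compute these
    ranks, whence five nested loops of [n] rounds each and [O(n^5)] steps.
    Every value that the program records comes from actual sets [X], [Z1] and
    [Z2] ([candidate_sound]), so it is at least the robust value; conversely
    no such sets beat the recorded minimum ([search_le]). *)

(** * A running-time bound read off the program text *)

(** Every loop of the solver runs exactly [N] rounds, so its running time is at
    most a function of the syntax and of [N] alone. This removes all time
    bookkeeping from the correctness proof. *)
Fixpoint time_bound (N : nat) (P : com) : nat :=
  match P with
  | Skip => 1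
  | IWrite a e => (icost a + icost e).+1
  | RWrite a e => (icost a + rcost e).+1
  | Seq P1 P2 => time_bound N P1 + time_bound N P2
  | If b P1 P2 => (bcost b + maxn (time_bound N P1) (time_bound N P2)).+1
  | While b P1 => N * (bcost b + time_bound N P1).+1 + (bcost b).+1
  end.

Fixpoint loop_depth (P : com) : nat :=
  match P with
  | Seq P1 P2 | If _ P1 P2 => maxn (loop_depth P1) (loop_depth P2)
  | While _ P1 => (loop_depth P1).+1
  | _ => 0
  end.

(** Each enclosing loop multiplies the time by at most [N]; the constant in front
    is the bound for loops of a single round. *)
Lemma time_bound_poly (N : nat) (P : com) : (0 < N)%N ->
  (time_bound N P <= time_bound 1 P * N ^ loop_depth P)%N.
Proof.
move=> N0.
have leX d e : (d <= e)%N -> (N ^ d <= N ^ e)%N by move=> ?; rewrite leq_pexp2l.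
have gt0X d : (0 < N ^ d)%N by rewrite expn_gt0 N0.
elim: P => [|a e|a e|P IHP Q IHQ|b P IHP Q IHQ|b P IHP] //=; rewrite ?expn0 ?muln1 //.
- rewrite mulnDl; apply: leq_add.
    by apply: (leq_trans IHP); rewrite leq_mul2l leX ?orbT ?leq_maxl.
  by apply: (leq_trans IHQ); rewrite leq_mul2l leX ?orbT ?leq_maxr.
- have h1 : (time_bound N P <= time_bound 1 P * N ^ maxn (loop_depth P) (loop_depth Q))%N.
    by apply: (leq_trans IHP); rewrite leq_mul2l leX ?orbT ?leq_maxl.
  have h2 : (time_bound N Q <= time_bound 1 Q * N ^ maxn (loop_depth P) (loop_depth Q))%N.
    by apply: (leq_trans IHQ); rewrite leq_mul2l leX ?orbT ?leq_maxr.
  have := gt0X (maxn (loop_depth P) (loop_depth Q)).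
  move: (N ^ _)%N h1 h2 => z h1 h2 z0.
  have : (bcost b <= bcost b * z)%N by rewrite leq_pmulr.
  rewrite mulSn mulnDl maxnMl; lia.
- rewrite mul1n expnS; have := gt0X (loop_depth P).
  move: (N ^ _)%N IHP => z IHP z0.
  have h : (bcost b + time_bound N P < (bcost b + time_bound 1 P).+1 * z)%N.
    have : (bcost b <= bcost b * z)%N by rewrite leq_pmulr.
    by rewrite mulSn mulnDl; lia.
  rewrite mulnDl; apply: leq_add.
    by rewrite mulnCA leq_mul2l h orbT.
  by rewrite leq_pmulr // muln_gt0 N0.
Qed.

(** * Execution on finite lists of cells *)

Section Execution.
Variables (R : realType) (input : nat -> R) (N : nat).
Implicit Types (iv : seq int) (rv : seq R) (P : com) (Q : seq int -> seq R -> Prop).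

(** The solver keeps its integer variables in the first nonnegative cells and its
    real variables in the negative ones, so that the costs, which fill the
    nonnegative real cells, stay intact until the output is written. Describing
    the state by two lists makes symbolic execution a computation on lists. *)
Definition state_of iv rv : state R :=
  State (fun z => if z is Posz m then nth 0 iv m else 0)
        (fun z => match z with Posz m => input m | Negz m => nth 0 rv m end).

Fixpoint ivalue iv (e : iexp) : int :=
  match e with
  | IConst z => z
  | IRead a => if ivalue iv a is Posz m then nth 0 iv m else 0
  | IAdd e1 e2 => ivalue iv e1 + ivalue iv e2
  | ISub e1 e2 => ivalue iv e1 - ivalue iv e2
  end.

Fixpoint rvalue iv rv (e : rexp) : R :=
  match e with
  | RConst z => z%:~R
  | RRead a => match ivalue iv a with Posz m => input m | Negz m => nth 0 rv m end
  | RAdd e1 e2 => rvalue iv rv e1 + rvalue iv rv e2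
  | RSub e1 e2 => rvalue iv rv e1 - rvalue iv rv e2
  | RMul e1 e2 => rvalue iv rv e1 * rvalue iv rv e2
  | RDiv e1 e2 => rvalue iv rv e1 / rvalue iv rv e2
  end.

Fixpoint bvalue iv rv (b : bexp) : bool :=
  match b with
  | BIle e1 e2 => ivalue iv e1 <= ivalue iv e2
  | BRle e1 e2 => rvalue iv rv e1 <= rvalue iv rv e2
  | BNot b1 => ~~ bvalue iv rv b1
  | BAnd b1 b2 => bvalue iv rv b1 && bvalue iv rv b2
  end.

Lemma ieval_state_of iv rv e : ieval (state_of iv rv) e = ivalue iv e.
Proof. by elim: e => //= [a ->|e1 -> e2 ->|e1 -> e2 ->]. Qed.

Lemma reval_state_of iv rv e : reval (state_of iv rv) e = rvalue iv rv e.
Proof.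
by elim: e => //= [a|e1 -> e2 ->|e1 -> e2 ->|e1 -> e2 ->|e1 -> e2 ->];
  rewrite ?ieval_state_of.
Qed.

Lemma beval_state_of iv rv b : beval (state_of iv rv) b = bvalue iv rv b.
Proof.
by elim: b => //= [e1 e2|e1 e2|b ->|b1 -> b2 ->]; rewrite ?ieval_state_of ?reval_state_of.
Qed.

(** Total correctness with postcondition [Q], within the syntactic time bound. *)
Definition run P iv rv Q : Prop :=
  exists t iv' rv',
    [/\ exec P (state_of iv rv) t (state_of iv' rv'), (t <= time_bound N P)%N & Q iv' rv'].

Lemma run_skip iv rv Q : Q iv rv -> run Skip iv rv Q.
Proof. by move=> h; exists 1%N, iv, rv; split=> //; exact: ExecSkip. Qed.

Lemma run_iwrite k e iv rv Q :
  Q (set_nth 0 iv k (ivalue iv e)) rv -> run (IWrite (IConst (Posz k)) e) iv rv Q.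
Proof.
move=> h; exists (time_bound N (IWrite (IConst (Posz k)) e)),
  (set_nth 0 iv k (ivalue iv e)), rv.
split=> //; rewrite -(ieval_state_of iv rv).
set s' := state_of (set_nth _ _ _ _) _.
suff -> : s' = State (upd (imem (state_of iv rv)) k (ieval (state_of iv rv) e))
    (rmem (state_of iv rv)) by exact: ExecIWrite.
by congr State; apply/funext => -[m|m] //; rewrite /upd /= nth_set_nth.
Qed.

Lemma run_rwrite k e iv rv Q :
  Q iv (set_nth 0 rv k (rvalue iv rv e)) -> run (RWrite (IConst (Negz k)) e) iv rv Q.
Proof.
move=> h; exists (time_bound N (RWrite (IConst (Negz k)) e)), iv,
  (set_nth 0 rv k (rvalue iv rv e)).
split=> //; rewrite -(reval_state_of iv rv).
set s' := state_of _ (set_nth _ _ _ _); suff -> : s' = State (imem (state_of iv rv))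
    (upd (rmem (state_of iv rv)) (Negz k) (reval (state_of iv rv) e)) by exact: ExecRWrite.
by congr State; apply/funext => -[m|m] //; rewrite /upd /= nth_set_nth.
Qed.

Lemma run_seq P1 P2 iv rv Q :
  run P1 iv rv (fun iv' rv' => run P2 iv' rv' Q) -> run (Seq P1 P2) iv rv Q.
Proof.
move=> [t1 [iv1 [rv1 [e1 l1 [t2 [iv2 [rv2 [e2 l2 q]]]]]]]].
by exists (t1 + t2)%N, iv2, rv2; split=> //=; [exact: ExecSeq e2|exact: leq_add].
Qed.

Lemma run_if b P1 P2 iv rv Q :
  run (if bvalue iv rv b then P1 else P2) iv rv Q -> run (If b P1 P2) iv rv Q.
Proof.
move=> [t [iv' [rv' [e l q]]]]; exists (bcost b + t).+1, iv', rv'; split=> //.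
  by apply: ExecIf; rewrite beval_state_of.
rewrite /= ltnS leq_add2l; apply: (leq_trans l).
by case: ifP => _; rewrite ?leq_maxl ?leq_maxr.
Qed.

Lemma run_weaken P iv rv Q Q' :
  run P iv rv Q' -> (forall iv' rv', Q' iv' rv' -> Q iv' rv') -> run P iv rv Q.
Proof.
by move=> [t [iv' [rv' [e l q]]]] h; exists t, iv', rv'; split=> //; exact: h.
Qed.

Lemma run_while b P (Inv : nat -> seq int -> seq R -> Prop) iv rv :
  Inv 0%N iv rv ->
  (forall m iv' rv', (m <= N)%N -> Inv m iv' rv' -> bvalue iv' rv' b = (m < N)%N) ->
  (forall m iv' rv', (m < N)%N -> Inv m iv' rv' -> run P iv' rv' (Inv m.+1)) ->
  run (While b P) iv rv (Inv N).
Proof.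
move=> I0 Hb HP.
suff H d m iv1 rv1 : (d + m)%N = N -> Inv m iv1 rv1 ->
   exists t iv' rv', [/\ exec (While b P) (state_of iv1 rv1) t (state_of iv' rv'),
     (t <= d * (bcost b + time_bound N P).+1 + (bcost b).+1)%N & Inv N iv' rv'].
  exact: (H N 0%N iv rv (addn0 N) I0).
elim: d m iv1 rv1 => [|d IH] m iv1 rv1 dm Im.
  have mN : m = N by [].
  exists (bcost b).+1, iv1, rv1; split=> //; last by rewrite -mN.
  by apply: ExecWhileF; rewrite beval_state_of (Hb m) // mN ?ltnn.
have mN : (m < N)%N by lia.
have [t1 [iv2 [rv2 [e1 l1 q1]]]] := HP _ _ _ mN Im.
have [t2 [iv3 [rv3 [e2 l2 q2]]]] := IH m.+1 iv2 rv2 (etrans (addnS d m) dm) q1.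
exists (bcost b + t1 + t2).+1, iv3, rv3; split=> //; last by rewrite mulSn; lia.
by apply: ExecWhileT e1 e2; rewrite beval_state_of (Hb m) // ltnW.
Qed.

End Execution.

(** * The program *)

Definition ivar (x : nat) : iexp := IRead (IConst (Posz x)).
Definition rvar (x : nat) : rexp := RRead (IConst (Negz x)).
Definition iset (x : nat) (e : iexp) : com := IWrite (IConst (Posz x)) e.
Definition rset (x : nat) (e : rexp) : com := RWrite (IConst (Negz x)) e.
Definition incr (x : nat) : com := iset x (IAdd (ivar x) (IConst 1)).
Definition BIlt (e1 e2 : iexp) : bexp := BNot (BIle e2 e1).
Definition BIeq (e1 e2 : iexp) : bexp := BAnd (BIle e1 e2) (BIle e2 e1).
Definition BOr (b1 b2 : bexp) : bexp := BNot (BAnd (BNot b1) (BNot b2)).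

(** Addresses of the integer variables ([v...]); a real variable [r...] of number
    [x] lives at address [-(x + 1)]. *)
Definition vp := 1%N.
Definition vi := 3%N.
Definition vj := 4%N.
Definition vk := 5%N.
Definition vt := 6%N.
Definition vu := 7%N.
Definition vcM := 8%N.
Definition vcL := 9%N.
Definition vcA := 10%N.
Definition vn1 := 11%N.
Definition vn2 := 12%N.
Definition vfound := 13%N.
Definition rc1 := 0%N.
Definition rc2 := 1%N.
Definition rbest := 2%N.

(** Cell 0 holds the number of items. *)
Definition For (x : nat) (P : com) : com :=
  Seq (iset x (IConst 0)) (While (BIlt (ivar x) (ivar 0)) (Seq P (incr x))).

Definition cost_of (x : nat) : rexp := RRead (ivar x).
Definition dev_of (x : nat) : rexp :=
  RSub (RRead (IAdd (ivar 0) (ivar x))) (RRead (ivar x)).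

Definition precedes_exp (x y : nat) : bexp :=
  BAnd (BRle (cost_of x) (cost_of y))
       (BNot (BAnd (BRle (cost_of y) (cost_of x)) (BIle (ivar y) (ivar x)))).
Definition light_exp (x : nat) : bexp := BRle (dev_of x) (dev_of vi).
Definition medium_exp (x : nat) : bexp :=
  BAnd (BNot (light_exp x)) (BRle (dev_of x) (dev_of vj)).

Definition count_com : com :=
  If (precedes_exp vu vt)
    (Seq (If (medium_exp vu) (incr vcM) Skip)
      (Seq (If (light_exp vu) (incr vcL) Skip) (incr vcA)))
    Skip.

Definition in_X_exp : bexp := BAnd (medium_exp vt) (BIlt (ivar vcM) (ivar vk)).
Definition in_Z1_exp : bexp :=
  BOr in_X_exp (BAnd (light_exp vt) (BIlt (IAdd (ivar vcL) (ivar vk)) (ivar vp))).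
(** The ranks among the items outside [X] are not counted by a loop of their own:
    of the [cM] medium predecessors exactly [min k cM] lie in [X], so the test
    [cA - min k cM < p - k] splits into the two inequalities below. *)
Definition in_Z2_exp : bexp :=
  BOr in_X_exp (BAnd (BIlt (ivar vcA) (ivar vp))
    (BIlt (IAdd (ivar vcA) (ivar vk)) (IAdd (ivar vp) (ivar vcM)))).

Definition item_com : com :=
  Seq (iset vcM (IConst 0)) (Seq (iset vcL (IConst 0)) (Seq (iset vcA (IConst 0))
  (Seq (For vu count_com)
  (Seq (If in_Z1_exp (Seq (incr vn1) (rset rc1 (RAdd (rvar rc1) (cost_of vt)))) Skip)
       (If in_Z2_exp (Seq (incr vn2) (rset rc2 (RAdd (rvar rc2) (cost_of vt)))) Skip))))).

Definition update_com : com :=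
  Seq (rset rc1 (RAdd (rvar rc1) (dev_of vi)))
  (Seq (rset rc2 (RAdd (rvar rc2) (dev_of vj)))
  (Seq (If (BRle (rvar rc1) (rvar rc2)) (rset rc1 (rvar rc2)) Skip)
  (If (BOr (BIeq (ivar vfound) (IConst 0)) (BRle (rvar rc1) (rvar rbest)))
     (Seq (iset vfound (IConst 1)) (rset rbest (rvar rc1))) Skip))).

Definition candidate_com : com :=
  Seq (iset vn1 (IConst 0)) (Seq (iset vn2 (IConst 0))
  (Seq (rset rc1 (RConst 0)) (Seq (rset rc2 (RConst 0))
  (Seq (For vt item_com)
  (If (BAnd (BIeq (ivar vn1) (ivar vp)) (BIeq (ivar vn2) (ivar vp))) update_com Skip))))).

(** For [p = 0] the only selection is empty and costs 0, the initial content of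
    the cell of the best value. The triples [(i, j, k)] may all have greater
    values, as these always include the deviations of two items. *)
Definition search_com : com :=
  Seq (If (BIeq (ivar vp) (IConst 0)) (iset vfound (IConst 1)) Skip)
      (For vi (For vj (For vk candidate_com))).

Definition output_com : com :=
  Seq (RWrite (IConst 0) (rvar rbest)) (IWrite (IConst 0) (ivar vfound)).

Definition solver : com := Seq search_com output_com.

Lemma loop_depth_solver : loop_depth solver = 5%N. Proof. by []. Qed.

(** * What the program computes *)

Section Solver.
Variables (R : realType) (input : nat -> R) (N : nat) (p : int).

Definition item_cost (t : nat) : R := input t.
(** The upper costs follow the lower costs in the input, at an offset of [N]. *)
Definition item_dev (t : nat) : R := input (N + t)%N - input t.
(** Ties are broken by index so that distinct items have distinct ranks. *)
Definition precedes (u t : nat) : bool :=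
  (item_cost u <= item_cost t) && ~~ ((item_cost t <= item_cost u) && (t <= u)%N).
Definition light (i t : nat) : bool := item_dev t <= item_dev i.
Definition medium (i j t : nat) : bool := ~~ light i t && (item_dev t <= item_dev j).

Definition count_medium i j t m : nat := \sum_(u < m) (precedes u t && medium i j u).
Definition count_light i t m : nat := \sum_(u < m) (precedes u t && light i u).
Definition count_all t m : nat := \sum_(u < m) precedes u t.

Definition in_X i j (k t : nat) : bool := medium i j t && (count_medium i j t N < k)%N.
Definition in_Z1 i j (k t : nat) : bool :=
  in_X i j k t || (light i t && ((count_light i t N + k)%N%:Z < p)).
Definition in_Z2 i j (k t : nat) : bool :=
  in_X i j k t || (((count_all t N)%:Z < p) &&
                  ((count_all t N + k)%N%:Z < p + (count_medium i j t N)%:Z)).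

Definition size_upto (Z : nat -> bool) m : nat := \sum_(t < m) Z t.
Definition cost_upto (Z : nat -> bool) m : R :=
  \sum_(t < m) (if Z t then item_cost t else 0).

Definition candidate i j k : \bar R :=
  if ((size_upto (in_Z1 i j k) N)%:Z == p) && ((size_upto (in_Z2 i j k) N)%:Z == p)
  then (Num.max (cost_upto (in_Z1 i j k) N + item_dev i)
                (cost_upto (in_Z2 i j k) N + item_dev j))%:E
  else +oo%E.

Definition icells (i j k t u cM cL cA n1 n2 : nat) (f : bool) : seq int :=
  [:: N%:Z; p; 1; i%:Z; j%:Z; k%:Z; t%:Z; u%:Z; cM%:Z; cL%:Z; cA%:Z;
      n1%:Z; n2%:Z; (f : nat)%:Z].

Lemma run_for x P (Inv : nat -> seq int -> seq R -> Prop) iv rv :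
  Inv 0%N (set_nth 0 iv x 0) rv ->
  (forall m iv' rv', Inv m iv' rv' -> nth 0 iv' x = m /\ nth 0 iv' 0 = N) ->
  (forall m iv' rv', (m < N)%N -> Inv m iv' rv' ->
     run input N P iv' rv'
       (fun iv2 rv2 => Inv m.+1 (set_nth 0 iv2 x (nth 0 iv2 x + 1)) rv2)) ->
  run input N (For x P) iv rv (Inv N).
Proof.
move=> I0 HI HP; apply: run_seq; apply: run_iwrite => /=.
apply: run_while => // [m iv' rv' mN /HI [/= -> ->]|m iv' rv' mN Im].
  by rewrite lez_nat ltnNge.
apply: run_seq; apply: run_weaken (HP _ _ _ mN Im) _ => iv2 rv2 h.
exact: run_iwrite.
Qed.

Lemma PoszS (m : nat) : m%:Z + 1 = m.+1%:Z. Proof. by rewrite -addn1 PoszD. Qed.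

Lemma bvalue_or iv (rv : seq R) b1 b2 :
  bvalue input iv rv (BOr b1 b2) = bvalue input iv rv b1 || bvalue input iv rv b2.
Proof. by rewrite /= -negb_or negbK. Qed.

Lemma run_count i j k t u cM cL cA n1 n2 f rv :
  run input N count_com (icells i j k t u cM cL cA n1 n2 f) rv
   (fun iv' rv' => iv' = icells i j k t u (cM + (precedes u t && medium i j u))
     (cL + (precedes u t && light i u)) (cA + precedes u t) n1 n2 f /\ rv' = rv).
Proof.
have e_precedes : bvalue input (icells i j k t u cM cL cA n1 n2 f) rv
  (precedes_exp vu vt) = precedes u t by [].
apply: run_if; rewrite e_precedes; case: (precedes u t); last first.
  by rewrite !addn0; apply: run_skip.
have e_medium c : bvalue input (icells i j k t u c cL cA n1 n2 f) rv
  (medium_exp vu) = medium i j u by [].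
have e_light c : bvalue input (icells i j k t u c cL cA n1 n2 f) rv
  (light_exp vu) = light i u by [].
rewrite !andTb; apply: run_seq; apply: run_if; rewrite e_medium.
apply: (run_weaken (Q' := fun iv' rv' => iv' = icells i j k t u (cM + medium i j u)
     cL cA n1 n2 f /\ rv' = rv)).
  case: (medium i j u); last by rewrite addn0; apply: run_skip.
  by apply: run_iwrite; rewrite /icells /= !PoszS addn1.
move=> _ _ [-> ->]; apply: run_seq; apply: run_if; rewrite e_light.
apply: (run_weaken (Q' := fun iv' rv' => iv' = icells i j k t u (cM + medium i j u)
     (cL + light i u) cA n1 n2 f /\ rv' = rv)).
  case: (light i u); last by rewrite addn0; apply: run_skip.
  by apply: run_iwrite; rewrite /icells /= !PoszS addn1.
by move=> _ _ [-> ->]; apply: run_iwrite; rewrite /icells /= !PoszS !addn1.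
Qed.

Lemma run_counts i j k t u cM cL cA n1 n2 f rv :
  cM = 0%N -> cL = 0%N -> cA = 0%N ->
  run input N (For vu count_com) (icells i j k t u cM cL cA n1 n2 f) rv
   (fun iv' rv' => iv' =
     icells i j k t N (count_medium i j t N) (count_light i t N) (count_all t N) n1 n2 f
     /\ rv' = rv).
Proof.
move=> -> -> ->.
apply: (run_for (Inv := fun m iv' rv' =>
  iv' = icells i j k t m (count_medium i j t m) (count_light i t m) (count_all t m) n1 n2 f
  /\ rv' = rv)).
- by rewrite /count_medium /count_light /count_all !big_ord0.
- by move=> m _ _ [-> _].
- move=> m _ _ mN [-> ->]; apply: run_weaken; first exact: run_count.
  move=> _ _ [-> ->]; rewrite /icells /= PoszS.
  by rewrite /count_medium /count_light /count_all !big_ord_recr.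
Qed.

Lemma run_item i j k t u cM cL cA n1 n2 f c1 c2 b :
  run input N item_com (icells i j k t u cM cL cA n1 n2 f) [:: c1; c2; b]
   (fun iv' rv' => iv' =
     icells i j k t N (count_medium i j t N) (count_light i t N) (count_all t N)
       (n1 + in_Z1 i j k t) (n2 + in_Z2 i j k t) f /\
     rv' = [:: c1 + (if in_Z1 i j k t then item_cost t else 0);
               c2 + (if in_Z2 i j k t then item_cost t else 0); b]).
Proof.
do 3 (apply: run_seq; apply: run_iwrite).
apply: run_seq; apply: run_weaken; first by apply: run_counts.
move=> _ _ [-> ->].
set m0 := count_medium _ _ _ _; set l0 := count_light _ _ _; set a0 := count_all _ _.
have e_X n1' rv' :
  bvalue input (icells i j k t N m0 l0 a0 n1' n2 f) rv' in_X_exp = in_X i j k t.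
  by rewrite /in_X -/m0 ltnNge -lez_nat.
have e_Z1 : bvalue input (icells i j k t N m0 l0 a0 n1 n2 f) [:: c1; c2; b] in_Z1_exp
  = in_Z1 i j k t.
  by rewrite /in_Z1_exp bvalue_or e_X /in_Z1 PoszD ltNge.
have e_Z2 n1' rv' :
  bvalue input (icells i j k t N m0 l0 a0 n1' n2 f) rv' in_Z2_exp = in_Z2 i j k t.
  by rewrite /in_Z2_exp bvalue_or e_X /in_Z2 PoszD !ltNge.
apply: run_seq; apply: run_if; rewrite e_Z1.
apply: (run_weaken (Q' := fun iv' rv' => iv' = icells i j k t N m0 l0 a0
    (n1 + in_Z1 i j k t) n2 f /\
  rv' = [:: c1 + (if in_Z1 i j k t then item_cost t else 0); c2; b])).
  case: (in_Z1 i j k t); last by rewrite addn0 addr0; apply: run_skip.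
  by apply: run_seq; apply: run_iwrite; apply: run_rwrite; rewrite /icells /= PoszS addn1.
move=> _ _ [-> ->]; apply: run_if; rewrite e_Z2.
case: (in_Z2 i j k t); last by rewrite addn0 addr0; apply: run_skip.
by apply: run_seq; apply: run_iwrite; apply: run_rwrite; rewrite /icells /= PoszS addn1.
Qed.

Definition incumbent (f : bool) (b : R) : \bar R := if f then b%:E else +oo%E.

(** The three outer loops only communicate through the incumbent [e]; the other
    variables hold leftovers of earlier rounds and are quantified away. *)
Definition at_loop (i j k : nat) (e : \bar R) (iv : seq int) (rv : seq R) : Prop :=
  exists t u cM cL cA n1 n2 f c1 c2 b,
    [/\ iv = icells i j k t u cM cL cA n1 n2 f, rv = [:: c1; c2; b] & e = incumbent f b].

Lemma run_update i j k t u cM cL cA n1 n2 f c1 c2 b :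
  run input N update_com (icells i j k t u cM cL cA n1 n2 f) [:: c1; c2; b]
    (at_loop i j k
      (Order.min (incumbent f b) (Num.max (c1 + item_dev i) (c2 + item_dev j))%:E)).
Proof.
do 2 (apply: run_seq; apply: run_rwrite).
set iv := icells _ _ _ _ _ _ _ _ _ _ _; rewrite [set_nth _ _ _ _]/=.
rewrite -/(item_dev i) -/(item_dev j).
set x := c1 + _; set y := c2 + _.
apply: run_seq; apply: run_if.
apply: (run_weaken (Q' := fun iv' rv' => iv' = iv /\ rv' = [:: Num.max x y; y; b])).
  rewrite [bvalue _ _ _ _]/= -/x -/y; case: leP => xy; last exact: run_skip.
  exact: run_rwrite.
move=> _ _ [-> ->]; apply: run_if; rewrite bvalue_or.
have -> : bvalue input iv [:: Num.max x y; y; b] (BIeq (ivar vfound) (IConst 0)) = ~~ f.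
  by rewrite {}/iv; case: f.
rewrite [bvalue _ _ _ _]/=; set z := Num.max x y.
case: ifP => h.
  apply: run_seq; apply: run_iwrite; apply: run_rwrite.
  exists t, u, cM, cL, cA, n1, n2, true, z, y, z; split=> //.
  rewrite /incumbent; case: f @iv h => _ //= h; rewrite ?min_r ?leey ?lee_fin //.
apply: run_skip; exists t, u, cM, cL, cA, n1, n2, f, z, y, b; split=> //.
rewrite /incumbent; case: f @iv h => _ //= /negbT; rewrite -ltNge => h.
by rewrite min_l // lee_fin ltW.
Qed.

Lemma run_candidate i j k e iv rv : at_loop i j k e iv rv ->
  run input N candidate_com iv rv (at_loop i j k (Order.min e (candidate i j k))).
Proof.
move=> [t [u [cM [cL [cA [n1 [n2 [f [c1 [c2 [b [-> -> ->]]]]]]]]]]]].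
do 2 (apply: run_seq; apply: run_iwrite).
do 2 (apply: run_seq; apply: run_rwrite).
apply: run_seq.
apply: (run_weaken (Q' := fun iv' rv' => exists u' cM' cL' cA',
   iv' = icells i j k N u' cM' cL' cA'
     (size_upto (in_Z1 i j k) N) (size_upto (in_Z2 i j k) N) f
   /\ rv' = [:: cost_upto (in_Z1 i j k) N; cost_upto (in_Z2 i j k) N; b])).
  apply: (run_for (Inv := fun m iv' rv' => exists u' cM' cL' cA',
   iv' = icells i j k m u' cM' cL' cA'
     (size_upto (in_Z1 i j k) m) (size_upto (in_Z2 i j k) m) f
   /\ rv' = [:: cost_upto (in_Z1 i j k) m; cost_upto (in_Z2 i j k) m; b])).
  - by exists u, cM, cL, cA; rewrite /size_upto /cost_upto !big_ord0.
  - by move=> m iv' rv' [u' [cM' [cL' [cA' [-> _]]]]].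
  - move=> m iv' rv' mN [u' [cM' [cL' [cA' [-> ->]]]]].
    apply: run_weaken; first exact: run_item.
    move=> _ _ [-> ->]; do 4 eexists; rewrite /icells [set_nth _ _ _ _]/= PoszS.
    by rewrite /size_upto /cost_upto !big_ord_recr.
move=> _ _ [u' [cM' [cL' [cA' [-> ->]]]]]; apply: run_if.
rewrite [bvalue _ _ _ _]/= /candidate -!eq_le.
case: ifP => _; first exact: run_update.
by apply: run_skip; rewrite min_l ?leey //; do 11 eexists; split.
Qed.

Lemma at_loopE i j k e iv rv : at_loop i j k e iv rv ->
  [/\ nth 0 iv 0 = N, nth 0 iv vi = i, nth 0 iv vj = j & nth 0 iv vk = k].
Proof. by move=> [t [u [cM [cL [cA [n1 [n2 [f [c1 [c2 [b [-> _ _]]]]]]]]]]]]. Qed.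

Lemma at_loop_seti i j k i' e iv rv : at_loop i j k e iv rv ->
  at_loop i' j k e (set_nth 0 iv vi i'%:Z) rv.
Proof.
move=> [t [u [cM [cL [cA [n1 [n2 [f [c1 [c2 [b [-> -> ->]]]]]]]]]]]].
by exists t, u, cM, cL, cA, n1, n2, f, c1, c2, b.
Qed.

Lemma at_loop_setj i j k j' e iv rv : at_loop i j k e iv rv ->
  at_loop i j' k e (set_nth 0 iv vj j'%:Z) rv.
Proof.
move=> [t [u [cM [cL [cA [n1 [n2 [f [c1 [c2 [b [-> -> ->]]]]]]]]]]]].
by exists t, u, cM, cL, cA, n1, n2, f, c1, c2, b.
Qed.

Lemma at_loop_setk i j k k' e iv rv : at_loop i j k e iv rv ->
  at_loop i j k' e (set_nth 0 iv vk k'%:Z) rv.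
Proof.
move=> [t [u [cM [cL [cA [n1 [n2 [f [c1 [c2 [b [-> -> ->]]]]]]]]]]]].
by exists t, u, cM, cL, cA, n1, n2, f, c1, c2, b.
Qed.

Definition search_k i j := iteri N (fun k e => Order.min e (candidate i j k)).
Definition search_j i := iteri N (fun j => search_k i j).
Definition search := iteri N search_j.

Lemma run_search_k i j k e iv rv : at_loop i j k e iv rv ->
  run input N (For vk candidate_com) iv rv (at_loop i j N (search_k i j e)).
Proof.
move=> H; apply: (run_for (Inv := fun k =>
    at_loop i j k (iteri k (fun k e => Order.min e (candidate i j k)) e))).
- exact: at_loop_setk H.
- by move=> m iv' rv' /at_loopE[].
- move=> m iv' rv' _ H'; apply: run_weaken (run_candidate H') _ => iv2 rv2 h.
  by case: (at_loopE h) => _ _ _ ->; rewrite PoszS; apply: at_loop_setk h.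
Qed.

Lemma run_search_j i j k e iv rv : at_loop i j k e iv rv ->
  run input N (For vj (For vk candidate_com)) iv rv
    (fun iv' rv' => exists k', at_loop i N k' (search_j i e) iv' rv').
Proof.
move=> H; apply: (run_for (Inv := fun j iv' rv' => exists k',
    at_loop i j k' (iteri j (fun j => search_k i j) e) iv' rv')).
- by exists k; apply: at_loop_setj H.
- by move=> m iv' rv' [k' /at_loopE[]].
- move=> m iv' rv' _ [k' H']; apply: run_weaken (run_search_k H') _ => iv2 rv2 h.
  by case: (at_loopE h) => _ _ -> _; exists N; rewrite PoszS; apply: at_loop_setj h.
Qed.

Lemma run_search i j k e iv rv : at_loop i j k e iv rv ->
  run input N (For vi (For vj (For vk candidate_com))) iv rv
    (fun iv' rv' => exists j' k', at_loop N j' k' (search e) iv' rv').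
Proof.
move=> H; apply: (run_for (Inv := fun i iv' rv' => exists j' k',
    at_loop i j' k' (iteri i search_j e) iv' rv')).
- by exists j, k; apply: at_loop_seti H.
- by move=> m iv' rv' [j' [k' /at_loopE[]]].
- move=> m iv' rv' _ [j' [k' H']]; apply: run_weaken (run_search_j H') _ => iv2 rv2 [k2 h].
  by case: (at_loopE h) => _ -> _ _; exists N, k2; rewrite PoszS; apply: at_loop_seti h.
Qed.

Lemma run_solver :
  exists t s, [/\ exec solver (state_of input [:: N%:Z; p; 1] [::]) t s,
     (t <= time_bound N solver)%N &
     decode_output s = search (incumbent (p == 0) 0)].
Proof.
(* Cells beyond the end of a list read as 0, so zeros may be appended. *)
have Emk : state_of input [:: N%:Z; p; 1] [::] =
    state_of input (icells 0 0 0 0 0 0 0 0 0 0 false) [:: 0; 0; 0].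
  by congr State; apply/funext => -[m|m] //;
    do 14 (case: m => [|m] //); rewrite /= !nth_nil.
suff [t [iv [rv [H l [j [k [t' [u [cM [cL [cA [n1 [n2 [f [c1 [c2 [b [Ei Er h]]]]]]]]]]]]]]]]]] :
  run input N search_com (icells 0 0 0 0 0 0 0 0 0 0 false) [:: 0; 0; 0]
   (fun iv' rv' => exists j' k', at_loop N j' k' (search (incumbent (p == 0) 0)) iv' rv').
  subst iv rv; rewrite Emk /solver; set s1 := state_of _ _ _ in H *.
  set s0 := state_of _ _ _ in H *.
  do 2 eexists; split; first exact: ExecSeq H (ExecSeq (ExecRWrite _ _ _) (ExecIWrite _ _ _)).
    by rewrite [time_bound _ _]/= leq_add.
  by rewrite h /decode_output /=; case: (f).
apply: run_seq; apply: run_if.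
apply: (run_weaken (Q' := at_loop 0 0 0 (incumbent (p == 0) 0))).
  rewrite [bvalue _ _ _ _]/= -eq_le; case: ifP => _.
    by apply: run_iwrite; exists 0,0,0,0,0,0,0,true,0,0,0.
  by apply: run_skip; exists 0,0,0,0,0,0,0,false,0,0,0.
by move=> iv rv H; apply: run_search H.
Qed.

End Solver.

(** * The cheapest items of a set *)

Lemma ler_sum_card (R : realType) (T : finType) (f : T -> R) (A B : {set T}) :
  #|A| = #|B| -> (forall x y, x \in A -> y \in B -> f x <= f y) ->
  \sum_(x in A) f x <= \sum_(x in B) f x.
Proof.
move=> cAB H; have [B0|B0] := posnP #|B|.
  by move: cAB; rewrite B0 => /cards0_eq ->; move/cards0_eq: B0 => ->.
(* Both sums, multiplied by the common cardinal, become sums over all pairs. *)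
rewrite -(ler_pMn2r B0) -{2}cAB -!sumr_const exchange_big /=.
rewrite [leRHS]exchange_big [leRHS]exchange_big /=.
by apply: ler_sum => y yB; apply: ler_sum => x xA; exact: H.
Qed.

Section Cheapest.
Variables (R : realType) (input : nat -> R) (N : nat).
Implicit Types (S Z : {set 'I_N}) (k : nat).

Lemma precedes_irr t : precedes input t t = false.
Proof. by rewrite /precedes leqnn lexx. Qed.

Lemma precedes_trans (s t u : nat) :
  precedes input s t -> precedes input t u -> precedes input s u.
Proof.
move=> /andP[st nst] /andP[tu ntu]; rewrite /precedes (le_trans st tu) /=.
apply/negP => /andP[us uls]; move: nst ntu.
rewrite (le_trans us st) (le_trans tu us) /= -!ltnNge => h1 h2; lia.
Qed.

Lemma precedes_total (t u : nat) : t != u -> precedes input t u || precedes input u t.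
Proof.
by rewrite /precedes neq_lt; case: (ltgtP (item_cost input t) (item_cost input u)) => //=; lia.
Qed.

Lemma precedes_le (t u : nat) :
  ~~ precedes input u t -> item_cost input t <= item_cost input u.
Proof.
by rewrite /precedes negb_and negbK => /orP[|/andP[]//]; rewrite -ltNge => /ltW.
Qed.

Definition rank S (t : nat) : nat := #|[set u in S | precedes input u t]|.

Definition cheapest S k : {set 'I_N} := [set t in S | (rank S t < k)%N].

Definition cost Z : R := \sum_(t in Z) item_cost input t.

Lemma cost_setD S Z : S \subset Z -> cost Z = cost S + cost (Z :\: S).
Proof. by move=> SZ; rewrite /cost (big_setID S) /= (setIidPr SZ). Qed.

Lemma cost_setU S Z : [disjoint S & Z] -> cost (S :|: Z) = cost S + cost Z.
Proof.
move=> dSZ; rewrite (cost_setD (subsetUl S Z)); congr (_ + cost _).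
by rewrite setDUl setDv set0U; apply/setDidPl; rewrite disjoint_sym.
Qed.

Lemma cheapest_sub S k : cheapest S k \subset S.
Proof. by apply/subsetP => t; rewrite inE => /andP[]. Qed.

Lemma rank_mono S (t u : 'I_N) : u \in S -> precedes input u t -> (rank S u < rank S t)%N.
Proof.
move=> uS ut; apply: proper_card; apply/properP; split.
  by apply/subsetP => s; rewrite !inE => /andP[-> /precedes_trans]; apply.
by exists u; rewrite !inE uS ?ut ?precedes_irr.
Qed.

(** Ranks in [S] are pairwise distinct and less than [#|S|], so they are exactly
    [0, ..., #|S| - 1]. *)
Lemma card_cheapest S k : #|cheapest S k| = minn k #|S|.
Proof.
have Urank : uniq [seq rank S t | t : 'I_N <- enum S].
  rewrite map_inj_in_uniq ?enum_uniq // => t u; rewrite !mem_enum => tS uS rtu.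
  apply/val_inj/eqP/negPn/negP => /precedes_total/orP[] /rank_mono => /(_ S).
    by move=> /(_ tS); rewrite rtu ltnn.
  by move=> /(_ uS); rewrite rtu ltnn.
have Prank : perm_eq [seq rank S t | t : 'I_N <- enum S] (iota 0 #|S|).
  apply: uniq_perm; rewrite ?iota_uniq //; apply: (uniq_min_size Urank _ _).2.
    move=> r /mapP[t]; rewrite mem_enum mem_iota /= add0n => tS ->.
    apply: proper_card; apply/properP; split.
      by apply/subsetP => s; rewrite !inE => /andP[].
    by exists t; rewrite // !inE precedes_irr andbF.
  by rewrite size_iota size_map -cardE.
have -> : #|cheapest S k| = count (fun r => r < k)%N [seq rank S t | t : 'I_N <- enum S].
  rewrite count_map -size_filter cardE /enum_mem -filter_predI; congr size.
  by apply: eq_filter => t; rewrite /= !inE andbC.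
rewrite (permP Prank); elim: #|S| => [|m IH]; first by rewrite minn0.
by rewrite -addn1 iotaD count_cat IH /= add0n addn0; lia.
Qed.

(** The predecessors of [t] in [cheapest S k] are the [k] cheapest among its
    predecessors in [S]. This is what lets the program deduce ranks outside
    [X] from its counters. *)
Lemma rank_cheapest S k t : rank (cheapest S k) t = minn k (rank S t).
Proof.
rewrite -card_cheapest; congr #|pred_of_set _|; apply/setP => u; rewrite !inE.
case: (boolP (u \in S)) => //= uS.
case: (boolP (precedes input u t)) => ut; rewrite ?andbF //= andbT.
congr (_ < k)%N; congr #|pred_of_set _|; apply/setP => s; rewrite !inE.
by case: (boolP (precedes input s u)) => [/precedes_trans /(_ ut) ->|]; rewrite ?andbF ?andbT.
Qed.

Lemma cheapest_le S k t u : t \in cheapest S k -> u \in S :\: cheapest S k ->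
  item_cost input t <= item_cost input u.
Proof.
rewrite !inE => /andP[tS tk] /andP[/nandP[/negP//|nuk] uS].
by apply: precedes_le; apply: contra nuk => /(rank_mono uS) /ltn_trans; apply.
Qed.

(** Replacing items of [Z] that lie in [S] by the missing cheapest items of [S]
    never increases the cost. As [Z] may leave [S], this handles at once the
    best [k]-subset of [S] and the best set containing [k] items of [S]. *)
Lemma cheapest_exchange S Z k : (k <= #|Z :&: S|)%N ->
  exists Z', [/\ cheapest S k \subset Z', #|Z'| = #|Z| & cost Z' <= cost Z].
Proof.
move=> kZS; set F := cheapest S k.
have FS : F \subset S by exact: cheapest_sub.
have cF : #|F| = k.
  rewrite card_cheapest; apply/minn_idPl; apply: (leq_trans kZS).
  by rewrite subset_leq_card // subsetIr.
(* The items E enter and equally many items D of S leave; D is taken as a greedy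
   subset of B only in order to have the right cardinal. *)
set E := F :\: Z; set B := (Z :&: S) :\: F; set D := cheapest B #|E|.
have DB : D \subset B by exact: cheapest_sub.
have cD : #|D| = #|E|.
  rewrite card_cheapest; apply/minn_idPl; rewrite !cardsD cF.
  by apply: leq_sub => //; rewrite subset_leq_card // setIC setIS // subsetIl.
have DZ : D \subset Z by apply: subset_trans DB _; apply/subsetP => t; rewrite !inE => /and3P[].
have dis : [disjoint Z :\: D & E].
  by rewrite -setI_eq0; apply/eqP/setP => t; rewrite !inE; case: (t \in Z); rewrite ?andbF.
exists ((Z :\: D) :|: E); split.
- apply/subsetP => t tF; rewrite !in_setU !in_setD tF andbT.
  case: (boolP (t \in Z)) => tZ; rewrite ?orbT ?orbF ?andbT //.
  by apply/negP => /(subsetP DB); rewrite in_setD tF.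
- have cDZ := subset_leq_card DZ.
  rewrite cardsU; move: dis; rewrite -setI_eq0 => /eqP ->.
  by rewrite cards0 subn0 cardsD (setIidPr DZ) -cD subnK.
- rewrite (cost_setU dis) (cost_setD DZ) [leRHS]addrC lerD2l.
  apply: ler_sum_card => // t u.
  rewrite in_setD => /andP[_ tF] /(subsetP DB); rewrite in_setD in_setI => /and3P[uF _ uS].
  by apply: (cheapest_le tF); rewrite in_setD uF.
Qed.

Lemma cheapest_min S Z k : Z \subset S -> #|Z| = k -> cost (cheapest S k) <= cost Z.
Proof.
move=> ZS cZ; have [|Z' [FZ' cZ']] := @cheapest_exchange S Z k.
  by rewrite (setIidPl ZS) cZ.
suff -> : Z' = cheapest S k by [].
apply/esym/eqP; rewrite eqEcard FZ' cZ' card_cheapest cZ leq_min leqnn /=.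
by rewrite -cZ subset_leq_card.
Qed.

End Cheapest.

(** * Candidate values and selections *)

Lemma le_iteri (R : realType) (z : \bar R) (f : nat -> \bar R -> \bar R)
    (P : nat -> Prop) n e :
  (forall i e', (z <= f i e')%E <-> (z <= e')%E /\ P i) ->
  (z <= iteri n f e)%E <-> (z <= e)%E /\ (forall i, (i < n)%N -> P i).
Proof.
move=> fP; elim: n => [|n IH] /=; first by split=> [ze|[]].
rewrite fP IH; split=> [[[ze H] Pn]|[ze H]].
  by split=> // i; rewrite ltnS leq_eqVlt => /predU1P[->|/H].
by split; [split=> // i iN; apply: H; exact: ltnW|exact: H].
Qed.

Section Candidates.
Variables (R : realType) (input : nat -> R) (N : nat) (p : int).
Implicit Types (X Z : {set 'I_N}) (i j t : 'I_N) (k : nat).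

Lemma le_search (z e : \bar R) :
  (z <= search input N p e)%E <->
  (z <= e)%E /\ (forall i j k : nat, (i < N)%N -> (j < N)%N -> (k < N)%N ->
    (z <= candidate input N p i j k)%E).
Proof.
rewrite (le_iteri (P := fun i : nat => forall j : nat, (j < N)%N -> forall k, (k < N)%N ->
  (z <= candidate input N p i j k)%E)).
  split=> [[ze H]|[ze H]]; split=> //.
    by move=> i j k iN jN kN; exact: H.
  by move=> i iN j jN k kN; exact: H.
move=> i e'; apply: le_iteri => j e2; apply: le_iteri => k e3.
by rewrite le_min; split=> [/andP|[-> ->]].
Qed.

Lemma size_uptoE (Z : nat -> bool) : size_upto Z N = #|[set t : 'I_N | Z t]|.
Proof.
rewrite -sum1_card big_mkcond; apply: eq_bigr => t _.
by rewrite inE; case: (Z t).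
Qed.

Lemma cost_uptoE (Z : nat -> bool) : cost_upto input Z N = cost input [set t : 'I_N | Z t].
Proof.
by rewrite /cost [RHS]big_mkcond; apply: eq_bigr => t _; rewrite inE.
Qed.

(** The sets that the program builds are admissible whether or not they are
    optimal, so soundness does not involve the greedy choice. *)
Lemma candidate_sound (i j k : nat) : candidate input N p i j k = +oo%E \/
  exists X Z1 Z2,
    [/\ X \subset Z1, X \subset Z2, #|Z1|%:Z = p & #|Z2|%:Z = p] /\
    [/\ (forall t, t \in Z1 :\: X -> item_dev input N t <= item_dev input N i),
        (forall t, t \in X -> item_dev input N t <= item_dev input N j) &
        candidate input N p i j k = (Num.max (cost input Z1 + item_dev input N i)
                                      (cost input Z2 + item_dev input N j))%:E].
Proof.
rewrite /candidate; case: ifP => [/andP[/eqP s1 /eqP s2]|_]; last by left.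
right; exists [set t : 'I_N | in_X input N i j k t], [set t : 'I_N | in_Z1 input N p i j k t],
  [set t : 'I_N | in_Z2 input N p i j k t]; split; split.
- by apply/subsetP => t; rewrite !inE /in_Z1 => ->.
- by apply/subsetP => t; rewrite !inE /in_Z2 => ->.
- by rewrite -size_uptoE.
- by rewrite -size_uptoE.
- by move=> t; rewrite !inE /in_Z1 => /andP[/negbTE-> /= /andP[]].
- by move=> t; rewrite inE => /andP[/andP[]].
- by rewrite !cost_uptoE.
Qed.

(** Optimality of the greedy choice for thresholds [i], [j] and size [#|X|]: the same
    [k] cheapest medium items serve both terms of the maximum. *)
Lemma candidate_le i j X Z1 Z2 :
  X \subset Z1 -> X \subset Z2 -> #|Z1|%:Z = p -> #|Z2|%:Z = p ->
  (forall t, t \in X -> medium input N i j t) ->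
  (forall t, t \in Z1 :\: X -> light input N i t) ->
  (candidate input N p i j #|X| <= (Num.max (cost input Z1 + item_dev input N i)
                                     (cost input Z2 + item_dev input N j))%:E)%E.
Proof.
move=> XZ1 XZ2 cZ1 cZ2 XM ZL; set k := #|X|; set q := #|Z1|.
set M := [set t : 'I_N | medium input N i j t]; set L := [set t : 'I_N | light input N i t].
have kq : (k <= q)%N by exact: subset_leq_card.
have cZ2q : #|Z2| = q by apply/eqP; rewrite -eqz_nat cZ2 cZ1.
have XMs : X \subset M by apply/subsetP => t /XM; rewrite inE.
have YLs : Z1 :\: X \subset L by apply/subsetP => t /ZL; rewrite inE.
have cY : #|Z1 :\: X| = (q - k)%N by rewrite cardsD (setIidPr XZ1).
set X' := cheapest input M k; set Y' := cheapest input L (q - k).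
set W' := cheapest input (~: X') (q - k).
have cX' : #|X'| = k.
  by rewrite card_cheapest; apply/minn_idPl; exact: subset_leq_card.
have cY' : #|Y'| = (q - k)%N.
  by rewrite card_cheapest; apply/minn_idPl; rewrite -cY; exact: subset_leq_card.
have cW' : #|W'| = (q - k)%N.
  rewrite card_cheapest; apply/minn_idPl; rewrite cardsCs setCK cX' leq_sub2r //.
  exact: max_card.
have rM t : count_medium input N i j t N = rank input M t.
  apply: (etrans (size_uptoE (fun u => precedes input u t && medium input N i j u))).
  congr #|pred_of_set _|.
  by apply/setP => u; rewrite !inE andbC.
have rL t : count_light input N i t N = rank input L t.
  apply: (etrans (size_uptoE (fun u => precedes input u t && light input N i u))).
  congr #|pred_of_set _|.
  by apply/setP => u; rewrite !inE andbC.
have rA t : count_all input t N = rank input [set: 'I_N] t.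
  apply: (etrans (size_uptoE (fun u => precedes input u t))); congr #|pred_of_set _|.
  by apply/setP => u; rewrite !inE.
have EX : [set t : 'I_N | in_X input N i j k t] = X'.
  by apply/setP => t; rewrite !inE /in_X rM.
have EZ1 : [set t : 'I_N | in_Z1 input N p i j k t] = X' :|: Y'.
  apply/setP => t; rewrite in_setU -EX !inE /in_Z1 -cZ1 ltz_nat rL.
  by congr (_ || (_ && _)); rewrite ltn_subRL addnC.
have rW t : rank input (~: X') t = (rank input [set: 'I_N] t - minn k (rank input M t))%N.
  rewrite -rank_cheapest /rank -/X'.
  rewrite -(cardsID X' [set u in [set: 'I_N] | precedes input u t]) addnC.
  set c1 := #|pred_of_set (_ :&: _)|.
  have -> : c1 = #|[set u in X' | precedes input u t]|.
    by congr #|pred_of_set _|; apply/setP => u; rewrite in_setI !in_set andTb andbC.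
  rewrite addnK; congr #|pred_of_set _|; apply/setP => u.
  by rewrite in_setD in_set in_setC !in_set andTb.
have EZ2 : [set t : 'I_N | in_Z2 input N p i j k t] = X' :|: W'.
  apply/setP => t; rewrite in_setU in_set /in_Z2 -cZ1 -/q rA rM.
  have -> : (t \in W') = (t \notin X') && (rank input (~: X') t < q - k)%N.
    by rewrite in_set in_setC.
  have <- : in_X input N i j k t = (t \in X') by rewrite -EX in_set.
  have : (rank input M t <= rank input [set: 'I_N] t)%N.
    by apply: subset_leq_card; apply/subsetP => u; rewrite !inE => /andP[_ ->].
  rewrite rW; case: (in_X input N i j k t) => //=; rewrite -PoszD !ltz_nat.
  by move: (rank _ _ _) (rank _ _ _) => m r; lia.
have dY : [disjoint X' & Y'].
  rewrite -setI_eq0; apply/eqP/setP => t; rewrite in_setI in_set0.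
  apply/negP => /andP[/(subsetP (cheapest_sub _ _ _))]; rewrite inE => /andP[tL _].
  by move=> /(subsetP (cheapest_sub _ _ _)); rewrite inE (negbTE tL).
have dW : [disjoint X' & W'].
  rewrite -setI_eq0; apply/eqP/setP => t; rewrite in_setI in_set0.
  by apply/negP => /andP[tX /(subsetP (cheapest_sub _ _ _))]; rewrite in_setC tX.
rewrite /candidate !size_uptoE !cost_uptoE EZ1 EZ2 !cardsU.
have [/eqP -> /eqP ->] : X' :&: Y' == finset.set0 /\ X' :&: W' == finset.set0.
  by rewrite !setI_eq0.
rewrite !cards0 cX' cY' cW' subn0 subnKC // cZ1 eqxx /= lee_fin.
have XX' : cost input X' <= cost input X by exact: cheapest_min.
have h1 : cost input (X' :|: Y') <= cost input Z1.
  by rewrite cost_setU // (cost_setD input XZ1) lerD //; exact: cheapest_min.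
have [|Z' [XZ' cZ' lZ']] := @cheapest_exchange _ input _ M Z2 k.
  by apply: subset_leq_card; rewrite subsetI XZ2.
have h2 : cost input (X' :|: W') <= cost input Z2.
  apply: le_trans lZ'; rewrite cost_setU // (cost_setD input XZ') lerD //.
  apply: cheapest_min; first by rewrite setDE subsetIr.
  by rewrite cardsD (setIidPr XZ') cX' cZ' cZ2q.
by rewrite ge_max !le_max !lerD2r h1 h2 orbT.
Qed.

(** The threshold [i] is the worst item of [Z1 :\: X]; the items of [X] that are light
    for [i] are moved to the second stage, and [j] is the worst of the others. *)
Lemma search_le X Z1 Z2 (al be : R) :
  X \subset Z1 -> X \subset Z2 -> #|Z1|%:Z = p -> #|Z2|%:Z = p ->
  0 <= al -> (forall t, t \in Z1 :\: X -> item_dev input N t <= al) ->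
  (forall t, t \in X -> item_dev input N t <= be) ->
  (search input N p (incumbent (p == 0)%R 0%R) <=
     (Num.max (cost input Z1 + al) (cost input Z2 + be))%:E)%E.
Proof.
move=> XZ1 XZ2 cZ1 cZ2 al0 Hal Hbe.
have e00 : p = 0 -> incumbent (p == 0) (0 : R) = 0%:E by move=> ->; rewrite eqxx.
move: (incumbent _ _) e00 => e e00.
have [ze zc] := (le_search (search input N p e) e).1 (lexx _).
have [p0|p0] := eqVneq p 0.
  apply: (le_trans ze); rewrite e00 // lee_fin le_max.
  move: cZ1; rewrite p0 => -[] /eqP; rewrite cards_eq0 => /eqP ->.
  by rewrite /cost big_set0 add0r al0.
pose argmax := fun (S : {set 'I_N}) t0 (t0S : t0 \in S) =>
  arg_maxP (fun t : 'I_N => item_dev input N t) t0S.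
(* With an empty first stage both terms are governed by the worst item of Z1. *)
have single i : (forall t, t \in Z1 -> item_dev input N t <= item_dev input N i) ->
    (search input N p e <= (cost input Z1 + item_dev input N i)%:E)%E.
  move=> Hi; have := @candidate_le i i finset.set0 Z1 Z1; rewrite maxxx cards0 => H.
  apply: le_trans (H _ _ _ _ _ _); rewrite ?sub0set //.
  - by apply: zc; rewrite ?ltn_ord // (leq_ltn_trans _ (ltn_ord i)).
  - by move=> t; rewrite inE.
  - by move=> t; rewrite setD0; exact: Hi.
(* If nothing is left for the second stage, Z1 = Z2 = X, and the same cost is
   obtained by buying everything in the second stage. *)
have [YE|[t0 t0Y]] := set_0Vmem (Z1 :\: X).
  have Z1X : Z1 = X.
    by apply/eqP; rewrite eqEsubset XZ1 andbT -setD_eq0 YE.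
  have Z21 : Z2 = Z1.
    apply/esym/eqP; rewrite eqEcard Z1X XZ2 -Z1X -lez_nat cZ1 cZ2 /=.
    exact: lexx.
  have [Z10|[t1 t1X]] := set_0Vmem Z1.
    by move: cZ1 p0; rewrite Z10 cards0 => <-; rewrite eqxx.
  case: (argmax _ _ t1X) => j jX jmax.
  apply: (le_trans (single j jmax)); rewrite lee_fin le_max Z21 !lerD2l Hbe ?orbT //.
  by rewrite -Z1X.
case: (argmax _ _ t0Y) => i iY imax.
set X' := [set t in X | ~~ light input N i t].
have X'X : X' \subset X by apply/subsetP => t; rewrite inE => /andP[].
have Y'L t : t \in Z1 :\: X' -> light input N i t.
  rewrite !inE => /andP[+ tZ]; case: (boolP (t \in X)) => //= tX; first by rewrite negbK.
  move=> _; apply: imax; by apply/setDP; split.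
have [X'0|[t1 t1X]] := set_0Vmem X'.
  apply: (le_trans (single i _)).
    by move=> t tZ; apply: Y'L; rewrite X'0 setD0.
  by rewrite lee_fin le_max lerD2l Hal.
case: (argmax _ _ t1X) => j jX jmax.
apply: le_trans (le_trans (@candidate_le i j X' Z1 Z2 _ _ cZ1 cZ2 _ Y'L) _).
- apply: zc; rewrite ?ltn_ord // -[X in (_ < X)%N]card_ord.
  apply: proper_card; apply/properP; split; first exact/subsetP.
  have [_ iX] := setDP iY; by exists i => //; apply: contra iX => /(subsetP X'X).
- exact: subset_trans XZ1.
- exact: subset_trans XZ2.
- move=> t tX; apply/andP; split; last exact: jmax.
  by move: tX; rewrite in_set => /andP[].
- by rewrite lee_fin ge_max !le_max !lerD2l Hal // Hbe ?orbT // (subsetP X'X).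
Qed.

End Candidates.

(** * The robust value in terms of selections *)

Section Indicators.
Variables (R : realType) (n : nat).
Implicit Types (x y c d w : 'rV[R]_n) (S Z X : {set 'I_n}).

Definition indicator S : 'rV[R]_n := \row_i (i \in S)%:R.

Lemma zero_one_indicator S : zero_one (indicator S).
Proof. by move=> i; rewrite mxE; case: (i \in S); [right|left]. Qed.

Lemma zero_oneP x : zero_one x -> exists S, x = indicator S.
Proof.
move=> x01; exists [set i | x 0 i == 1]; apply/rowP => i; rewrite mxE inE.
by case: (x01 i) => ->; rewrite ?eqxx // eq_sym oner_eq0.
Qed.

Lemma sum_indicator S (f : 'I_n -> R) : \sum_i f i * indicator S 0 i = \sum_(i in S) f i.
Proof.
rewrite [RHS]big_mkcond; apply: eq_bigr => i _; rewrite mxE.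
by case: (i \in S); rewrite ?mulr1 ?mulr0.
Qed.

Lemma sum_indicator_card S : \sum_i indicator S 0 i = #|S|%:R.
Proof.
by rewrite -sumr_const -(sum_indicator S (fun=> 1)); apply: eq_bigr => i _; rewrite mul1r.
Qed.

Lemma indicator_setD X Z : X \subset Z -> indicator X + indicator (Z :\: X) = indicator Z.
Proof.
move=> XZ; apply/rowP => i; rewrite !mxE inE.
case: (boolP (i \in X)) => [/(fintype.subsetP XZ) -> | _]; first by rewrite addr0.
by rewrite add0r.
Qed.

Lemma X2_indicator (I : instance R n) X y : X2 I (indicator X) y ->
  exists Z, [/\ X \subset Z, #|Z|%:Z = psel I & y = indicator (Z :\: X)].
Proof.
move=> [y01 _ [/zero_oneP[Z EZ] sZ]]; exists Z.
have XZ : X \subset Z.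
  apply/fintype.subsetP => i iX; move/rowP/(_ i): EZ; rewrite !mxE iX.
  case: (i \in Z) => // /eqP; case: (y01 i) => ->; rewrite ?addr0 ?oner_eq0 //.
  by rewrite -mulr2n pnatr_eq0.
split=> //; last by apply: (addrI (indicator X)); rewrite indicator_setD.
by apply/eqP; rewrite -(eqr_int R) -sZ EZ sum_indicator_card.
Qed.

Lemma indicator_X2 (I : instance R n) X Z : X \subset Z -> #|Z|%:Z = psel I ->
  X2 I (indicator X) (indicator (Z :\: X)).
Proof.
move=> XZ cZ; split; first exact: zero_one_indicator.
  by move=> i; rewrite indicator_setD // mxE; case: (i \in Z).
by split; rewrite indicator_setD //; [exact: zero_one_indicator|rewrite sum_indicator_card -cZ].
Qed.

Lemma sum_single_le (w : 'I_n -> R) delta S al : 0 <= al ->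
  (forall i, i \in S -> w i <= al) -> zero_one delta -> \sum_i delta 0 i <= 1 ->
  \sum_(i in S) w i * delta 0 i <= al.
Proof.
move=> al0 wal d01 ds.
have d0 i : 0 <= delta 0 i by case: (d01 i) => ->.
apply: (@le_trans _ _ (al * \sum_i delta 0 i)); last by rewrite -[leRHS]mulr1 ler_wpM2l.
rewrite mulr_sumr (big_mkcond (mem S)); apply: ler_sum => i _ /=.
by case: ifP => iS; [rewrite ler_wpM2r // wal|rewrite mulr_ge0].
Qed.

(** The adversary's best use of one unit against [S]. A set [T] of at most one item
    also covers the case where [S] is empty. *)
Lemma ex_worst_single (w : 'I_n -> R) S : (forall i, 0 <= w i) ->
  exists T : {set 'I_n}, (#|T| <= 1)%N /\
    (forall i, i \in S -> w i <= \sum_(t in S) w t * indicator T 0 t).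
Proof.
move=> w0; have [->|[i0 i0S]] := set_0Vmem S.
  by exists finset.set0; split=> [|i]; rewrite ?cards0 ?inE.
case: (arg_maxP w i0S) => j jS jmax; exists [set j]; split=> [|i iS].
  by rewrite cards1.
rewrite (bigD1 j) //= big1 ?addr0 => [|t /andP[_ /negbTE tj]].
  by rewrite mxE set11 mulr1; exact: jmax.
by rewrite mxE inE tj mulr0.
Qed.

End Indicators.

Section Value.
Variables (R : realType) (n : nat) (I : instance R n).
Hypotheses (Ivalid : valid I) (Gamma1 : Gamma I = 1%N).
Hypotheses (lo_eq : clo I = dlo I) (hi_eq : chi I = dhi I).
Implicit Types (x y c d : 'rV[R]_n) (S Z X T : {set 'I_n}).

Let dev (i : 'I_n) : R := chi I 0 i - clo I 0 i.
Let sel_cost S : R := \sum_(i in S) clo I 0 i.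
(* Both stages have the same cost intervals, so [perturb] parametrises the
   uncertainty sets of both. *)
Let perturb T : 'rV[R]_n := \row_i (clo I 0 i + dev i * indicator R T 0 i).

Lemma dev_ge0 i : 0 <= dev i.
Proof. by have [/andP[_]] := Ivalid i; rewrite subr_ge0. Qed.

Lemma clo_ge0 i : 0 <= clo I 0 i.
Proof. by have [/andP[]] := Ivalid i. Qed.

Lemma perturb_ge0 T : nonneg (perturb T).
Proof.
by move=> i; rewrite !mxE addr_ge0 ?clo_ge0 // mulr_ge0 ?dev_ge0.
Qed.

Lemma U1P c : U1 I c -> exists T, (#|T| <= 1)%N /\ c = perturb T.
Proof.
move=> [_ [delta [/zero_oneP[T ->] Ec]]]; rewrite Gamma1 sum_indicator_card ler_nat => T1.
by exists T; split=> //; apply/rowP => i; rewrite Ec [RHS]mxE.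
Qed.

Lemma U1_perturb T : (#|T| <= 1)%N -> U1 I (perturb T).
Proof.
move=> T1; split; first exact: perturb_ge0.
exists (indicator R T); split; first exact: zero_one_indicator.
  by move=> i; rewrite mxE.
by rewrite Gamma1 sum_indicator_card ler_nat.
Qed.

(** Only items with a positive deviation consume budget in the first stage: a
    perturbed item with zero deviation leaves no trace in the cost vector. *)
Lemma U2E T d : U2 I (perturb T) d <->
  exists T', d = perturb T' /\ (#|T'| + #|[set i in T | dev i != 0%R]| <= 1)%N.
Proof.
have EF : \sum_i (perturb T 0 i - clo I 0 i) / (chi I 0 i - clo I 0 i) =
    #|[set i in T | dev i != 0]|%:R.
  rewrite -sum_indicator_card; apply: eq_bigr => i _; rewrite !mxE inE addrC addKr -/(dev i).
  case: (boolP (i \in T)) => _; rewrite ?mulr0 ?mul0r //= mulr1.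
  by have [->|d0] := eqVneq (dev i) 0%R; rewrite ?mul0r // divff.
split=> [[_ [delta [/zero_oneP[T' ->] Ed]]]|[T' [-> cT]]].
  rewrite Gamma1 EF sum_indicator_card lerBrDr -natrD ler_nat => cT.
  by exists T'; split=> //; apply/rowP => i; rewrite Ed -lo_eq -hi_eq [RHS]mxE.
split; first exact: perturb_ge0.
exists (indicator R T'); split; first exact: zero_one_indicator.
  by move=> i; rewrite mxE -lo_eq -hi_eq.
by rewrite Gamma1 EF sum_indicator_card lerBrDr -natrD ler_nat.
Qed.

Lemma dot_perturb T S :
  dot (perturb T) (indicator R S) = sel_cost S + \sum_(i in S) dev i * indicator R T 0 i.
Proof.
by rewrite /dot sum_indicator -big_split /=; apply: eq_bigr => i _; rewrite mxE.
Qed.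

Lemma sel_cost_setD X Z : X \subset Z -> sel_cost Z = sel_cost X + sel_cost (Z :\: X).
Proof. by move=> XZ; rewrite /sel_cost (big_setID X) /= (setIidPr XZ). Qed.

(** First stage [X]; the second stage completes [X] to [Z2] if the adversary has
    visibly spent its budget, and to [Z1] otherwise. *)
Lemma Rob_le X Z1 Z2 al be :
  X \subset Z1 -> X \subset Z2 -> #|Z1|%:Z = psel I -> #|Z2|%:Z = psel I ->
  0 <= al -> 0 <= be ->
  (forall i, i \in Z1 :\: X -> dev i <= al) -> (forall i, i \in X -> dev i <= be) ->
  (Rob I <= (Num.max (sel_cost Z1 + al) (sel_cost Z2 + be))%:E)%E.
Proof.
move=> XZ1 XZ2 cZ1 cZ2 al0 be0 Hal Hbe.
apply: ge_ereal_inf; eexists; first by exists (indicator R X) => //; exact: zero_one_indicator.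
apply: ge_ereal_sup => _ [c /U1P[T [T1 ->]] <-].
have s1 T' : (#|T'| <= 1)%N -> \sum_i indicator R T' 0 i <= 1.
  by move=> ?; rewrite sum_indicator_card -[1]/(1%:R) ler_nat.
have [D0|DT] := set_0Vmem [set i in T | dev i != 0].
  apply: ge_ereal_inf; exists (ereal_sup [set (dot (perturb T) (indicator R X) +
      dot d (indicator R (Z1 :\: X)))%:E | d in U2 I (perturb T)]).
    by exists (indicator R (Z1 :\: X)) => //; exact: indicator_X2.
  apply: ge_ereal_sup => _ [d /U2E[T' [-> cT]] <-]; rewrite lee_fin le_max; apply/orP; left.
  rewrite !dot_perturb [X in _ + X + _]big1 ?addr0.
    rewrite addrA -sel_cost_setD // lerD2l; apply: sum_single_le => //.
      exact: zero_one_indicator.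
    by apply: s1; exact: leq_trans (leq_addr _ _) cT.
  move=> i _; rewrite mxE; case: (boolP (i \in T)) => iT; rewrite ?mulr0 // mulr1.
  apply/eqP; apply: contraT => di; move/setP/(_ i): D0.
  by rewrite !inE iT di.
apply: ge_ereal_inf; exists (ereal_sup [set (dot (perturb T) (indicator R X) +
    dot d (indicator R (Z2 :\: X)))%:E | d in U2 I (perturb T)]).
  by exists (indicator R (Z2 :\: X)) => //; exact: indicator_X2.
apply: ge_ereal_sup => _ [d /U2E[T' [-> cT]] <-]; rewrite lee_fin le_max; apply/orP; right.
have -> : T' = finset.set0.
  apply/eqP; rewrite -cards_eq0; move: DT => [i iD].
  have : (0 < #|[set i in T | dev i != 0%R]|)%N by apply/card_gt0P; exists i.
  by move: cT; lia.
rewrite !dot_perturb [X in _ + (_ + X)]big1 ?addr0; last first.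
  by move=> i _; rewrite mxE inE mulr0.
rewrite addrAC -sel_cost_setD // lerD2l; apply: sum_single_le => //.
  exact: zero_one_indicator.
exact: s1.
Qed.

(** For a given [X] the adversary compares two strategies: wait, or strike the
    worst item of [X]. If waiting yields less than [v], as witnessed by some
    [Z1], then striking yields at least [v] against every [Z2]. *)
Lemma le_Rob (v : \bar R) :
  (forall X Z1 Z2 al be,
    X \subset Z1 -> X \subset Z2 -> #|Z1|%:Z = psel I -> #|Z2|%:Z = psel I ->
    0 <= al ->
    (forall i, i \in Z1 :\: X -> dev i <= al) -> (forall i, i \in X -> dev i <= be) ->
    (v <= (Num.max (sel_cost Z1 + al) (sel_cost Z2 + be))%:E)%E) ->
  (v <= Rob I)%E.
Proof.
move=> H; apply: le_ereal_inf_tmp => _ [x /zero_oneP[X ->] <-].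
pose G c := ereal_inf [set ereal_sup [set (dot c (indicator R X) + dot d y)%:E | d in U2 I c]
  | y in X2 I (indicator R X)].
have supG c : U1 I c -> (G c <= ereal_sup [set G c | c in U1 I])%E.
  by move=> cU; apply: ereal_sup_ubound; exists c.
have sel0 S : \sum_(i in S) dev i * indicator R finset.set0 0 i = 0.
  by apply: big1 => i _; rewrite mxE inE mulr0.
have c0U : U1 I (perturb finset.set0) by apply: U1_perturb; rewrite cards0.
have [h|h] := leP v (G (perturb finset.set0)).
  exact: le_trans h (supG _ c0U).
have [_ [y /X2_indicator[Z1 [XZ1 cZ1 ->]] <-] hv] := ereal_inf_lt h.
have [T1 [cT1 HT1]] := ex_worst_single (Z1 :\: X) dev_ge0.
have [T2 [cT2 HT2]] := ex_worst_single X dev_ge0.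
apply: le_trans (supG _ (U1_perturb cT2)).
apply: le_ereal_inf_tmp => _ [_ /X2_indicator[Z2 [XZ2 cZ2 ->]] <-].
have al0 : 0 <= \sum_(i in Z1 :\: X) dev i * indicator R T1 0 i.
  by apply: sumr_ge0 => i _; rewrite mulr_ge0 ?dev_ge0 // mxE.
have := H _ _ _ _ _ XZ1 XZ2 cZ1 cZ2 al0 HT1 HT2.
rewrite EFin_max le_max => /orP[le1|le2].
  suff : (v < v)%E by rewrite ltxx.
  apply: le_lt_trans hv; apply: (le_trans le1); apply: ereal_sup_ubound.
  exists (perturb T1).
    apply/U2E; exists T1; split=> //.
    suff -> : [set i in finset.set0 | dev i != 0] = finset.set0 :> {set 'I_n}.
      by rewrite cards0 addn0.
    by apply/setP => i; rewrite !inE.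
  by rewrite !dot_perturb sel0 addr0 addrA -sel_cost_setD.
apply: (le_trans le2); apply: ereal_sup_ubound; exists (perturb finset.set0).
  apply/U2E; exists finset.set0; split=> //; rewrite cards0 add0n.
  apply: leq_trans cT2; apply: subset_leq_card; apply/fintype.subsetP => i.
  by rewrite inE => /andP[].
by rewrite !dot_perturb sel0 addr0 addrAC -sel_cost_setD.
Qed.

End Value.

(** * Assembling the solver and its value *)

Lemma encode_state_of (R : realType) n (I : instance R n) : Gamma I = 1%N ->
  exists input, [/\ encode_instance I = state_of input [:: n%:Z; psel I; 1] [::],
    (forall i : 'I_n, input i = clo I 0 i) &
    (forall i : 'I_n, input (n + i)%N = chi I 0 i)].
Proof.
move=> G1; exists (nth 0 (flatten [seq [seq v 0 i | i <- enum 'I_n]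
   | v : 'rV[R]_n <- [:: clo I; chi I; dlo I; dhi I]])).
have sz (v : 'rV[R]_n) : size [seq v 0 i | i <- enum 'I_n] = n.
  by rewrite size_map size_enum_ord.
have nthv (v : 'rV[R]_n) (i : 'I_n) : nth 0 [seq v 0 i | i <- enum 'I_n] i = v 0 i.
  by rewrite (nth_map i) ?size_enum_ord // nth_ord_enum.
split=> [|i|i] /=.
- congr State; apply/funext => -[m|m] //=; rewrite ?nth_nil //.
  by do 3 (case: m => [|m] //=); rewrite ?G1 // nth_nil.
- by rewrite nth_cat sz ltn_ord nthv.
- by rewrite !nth_cat !sz ltnNge leq_addr /= addKn ltn_ord nthv.
Qed.

Theorem theorem22 (R : realType) :
  exists (P : com) (C : nat),
    forall (n : nat) (I : instance R n),
      valid I -> Gamma I = 1%N -> clo I = dlo I -> chi I = dhi I ->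
      exists (t : nat) (s : state R),
        [/\ exec P (encode_instance I) t s,
            decode_output s = Rob I
          & (0 < n)%N -> (t <= C * n ^ 5)%N].
Proof.
exists solver, (time_bound 1 solver) => n I Iv G1 lo_eq hi_eq.
have [input [-> Elo Ehi]] := encode_state_of G1.
have [t [s [ex le_t dec_s]]] := run_solver input n (psel I).
exists t, s; split=> //; last first.
  by move=> n0; rewrite -loop_depth_solver; exact: leq_trans le_t (time_bound_poly _ n0).
have Edev (i : 'I_n) : item_dev input n i = chi I 0 i - clo I 0 i.
  by rewrite /item_dev Ehi Elo.
have Ecost Z : cost input Z = \sum_(i in Z) clo I 0 i.
  by apply: eq_bigr => i _; rewrite /item_cost Elo.
rewrite dec_s; apply: le_anti; apply/andP; split.
  apply: (le_Rob Iv G1 lo_eq hi_eq) => X Z1 Z2 al be XZ1 XZ2 cZ1 cZ2 al0 Hal Hbe.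
  rewrite -!Ecost; apply: (search_le XZ1 XZ2 cZ1 cZ2 al0) => i; rewrite Edev.
    exact: Hal.
  exact: Hbe.
apply/le_search; split.
  rewrite /incumbent; case: eqVneq => [p0|_]; last exact: leey.
  have := @Rob_le R n I Iv G1 lo_eq hi_eq finset.set0 finset.set0 finset.set0 0 0.
  by rewrite big_set0 addr0 maxxx; apply; rewrite ?sub0set ?cards0 // => i; rewrite ?setD0 inE.
move=> i j k iN jN kN; have [->|] := candidate_sound input n (psel I) i j k; first exact: leey.
move=> [X [Z1 [Z2 [[XZ1 XZ2 cZ1 cZ2] [Hal Hbe ->]]]]].
have dev0 (i' : nat) : (i' < n)%N -> 0 <= item_dev input n i'.
  move=> lt_i; rewrite -[i']/(val (Ordinal lt_i)) Edev subr_ge0.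
  by have [/andP[]] := Iv (Ordinal lt_i).
rewrite !Ecost; apply: (Rob_le Iv G1 lo_eq hi_eq XZ1 XZ2 cZ1 cZ2 (dev0 _ iN) (dev0 _ jN)).
  by move=> t' /Hal; rewrite Edev.
by move=> t' /Hbe; rewrite Edev.
Qed.
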